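(* Let $\lambda\ge0$, $\Delta t>0$, $m\in\{0,\dots,M-1\}$, and let $(\mathcal{V}^{m+1},\varkappa^{m+1},\vec X^{m+1},\kappa^{m+1})\in V^h\times V^h\times[V^h]^2\times V^h$ be a solution of the nonlinear scheme (N) defined in the context. Then $$\bar{\mathcal{E}}^{m+1}+\Delta t\,\bigl(\mathcal{V}^{m+1},\,\mathcal{V}^{m+1}|\vec X^m_\rho|\bigr)\le\bar{\mathcal{E}}^m,$$ where $\bar{\mathcal{E}}^m=\tfrac12\bigl((\varkappa^m)^2,\,|\vec X^{m}_\rho|\bigr)+\lambda\bigl(|\vec X^m_\rho|,\,1\bigr)$.
   Context: $\mathbb{I}=\mathbb{R}/\mathbb{Z}$ is partitioned uniformly into $\mathbb{I}_j=[\rho_{j-1},\rho_j]$, $j=1,\dots,J$, with $\rho_j=jh$, $h=1/J$ ($\rho_0$ and $\rho_J$ are identified). $V^h=\{\chi\in C^0(\mathbb{I}):\chi|_{\mathbb{I}_j}\text{ is affine for } j=1,\dots,J\}$. $(\cdot,\cdot)$ is the $L^2$-inner product over $\mathbb{I}$ (for scalar or vector valued functions), and the mass-lumped inner product is $$(u,v)^h=\frac h2\sum_{j=1}^J\bigl[(u\cdot v)(\rho_j^-)+(u\cdot v)(\rho_{j-1}^+)\bigr],$$ for piecewise continuous $u,v$ with possible jumps at the nodes, where $u(\rho_j^\pm)=\lim_{\delta\searrow0}u(\rho_j\pm\delta)$. Subscript $\rho$ denotes the derivative in $\rho$; $(\cdot)^\perp$ denotes clockwise rotation by $\pi/2$.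 $[0,T]$ is divided uniformly with time step $\Delta t=T/M$, $t_m=m\Delta t$. Throughout, $\vec X^m\in[V^h]^2$ with $|\vec X^m_\rho|>0$ in $\mathbb{I}$ for $m=0,\dots,M$. Set $\vec\tau^m=\vec X^m_\rho|\vec X^m_\rho|^{-1}$ and $\vec\nu^m=-(\vec\tau^m)^\perp$. Nonlinear scheme (N): given $\vec X^0\in[V^h]^2$ and $\varkappa^0\in V^h$, for $m=0,\dots,M-1$ find $(\mathcal{V}^{m+1},\varkappa^{m+1},\vec X^{m+1},\kappa^{m+1})\in V^h\times V^h\times[V^h]^2\times V^h$ such that $$\bigl(\mathcal{V}^{m+1},\varphi^h|\vec X^m_\rho|\bigr)=\bigl(\varkappa^{m+1}_\rho,\varphi^h_\rho|\vec X^m_\rho|^{-1}\bigr)-\tfrac12\bigl((\varkappa^m)^2\varkappa^{m+1},\varphi^h|\vec X^m_\rho|\bigr)+\lambda\bigl(\kappa^{m+1},\varphi^h|\vec X^m_\rho|\bigr)\quad\forall\varphi^h\in V^h,$$ $$\Bigl(\frac{\varkappa^{m+1}-\varkappa^m}{\Delta t},\chi^h|\vec X^m_\rho|\Bigr)+\tfrac12\Bigl(\frac{\vec X^{m+1}_\rho-\vec X^m_\rho}{\Delta t}\cdot\vec X^{m+1}_\rho|\vec X^m_\rho|^{-1},\varkappa^{m+1}\chi^h\Bigr)$$ $$=-\bigl(\mathcal{V}^{m+1}_\rho,\chi^h_\rho|\vec X^m_\rho|^{-1}\bigr)+\tfrac12\bigl((\varkappa^m)^2\mathcal{V}^{m+1},\chi^h|\vec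 X^m_\rho|\bigr)+\tfrac12\Bigl(\vec\tau^m\cdot\frac{\vec X^{m+1}-\vec X^{m}}{\Delta t},\ \varkappa^{m+1}_\rho\chi^h-\varkappa^{m+1}\chi^h_\rho\Bigr)\quad\forall\chi^h\in V^h,$$ $$\Bigl(\vec\nu^m\cdot\frac{\vec X^{m+1}-\vec X^m}{\Delta t},\xi^h|\vec X^m_\rho|\Bigr)^h=\bigl(\mathcal{V}^{m+1},\xi^h|\vec X^m_\rho|\bigr)\quad\forall\xi^h\in V^h,$$ $$\bigl(\kappa^{m+1}\vec\nu^m,\vec\eta^h|\vec X^m_\rho|\bigr)^h=-\bigl(\vec X^{m+1}_\rho,\vec\eta^h_\rho|\vec X^m_\rho|^{-1}\bigr)\quad\forall\vec\eta^h\in[V^h]^2.$$ Note that $\varkappa^{m}$ and $\kappa^{m}$ are two independent unknowns. *)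

(* Defs.v *)
From Stdlib Require Import Reals Lra Lia.
From Coquelicot Require Import Coquelicot.
Open Scope R_scope.

(* Functions on R/Z are functions R -> R (or R -> R * R) of period 1; the
   period is required in [Vh]. *)

Definition mesh (J : nat) : R := / INR J.

Definition node (J j : nat) : R := INR j * mesh J.

Definition Vh (J : nat) (chi : R -> R) : Prop :=
  (forall rho, chi (rho + 1) = chi rho) /\
  (forall rho, continuous chi rho) /\
  (forall j, (1 <= j <= J)%nat ->
     exists a b : R, forall rho,
       node J (j - 1) <= rho <= node J j -> chi rho = a + b * rho).

Definition Vh2 (J : nat) (X : R -> R * R) : Prop :=
  Vh J (fun rho => fst (X rho)) /\ Vh J (fun rho => snd (X rho)).

Definition dot (u v : R * R) : R := fst u * fst v + snd u * snd v.

Definition enorm (v : R * R) : R := sqrt (dot v v).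

(* Clockwise rotation by PI / 2. *)
Definition perp (v : R * R) : R * R := (snd v, - fst v).

(* At a node where X has a kink the value is meaningless; the nodes are
   invisible to the integrals and one-sided limits in which it is used. *)
Definition Derive2 (X : R -> R * R) (rho : R) : R * R :=
  (Derive (fun r => fst (X r)) rho, Derive (fun r => snd (X r)) rho).

Definition speed (X : R -> R * R) (rho : R) : R := enorm (Derive2 X rho).

(* |X_rho| > 0, with X_rho the elementwise derivative: the kinks are excluded. *)
Definition regular (J : nat) (X : R -> R * R) : Prop :=
  forall j rho, (1 <= j <= J)%nat ->
    node J (j - 1) < rho < node J j -> 0 < speed X rho.

Definition tangent (X : R -> R * R) (rho : R) : R * R :=
  scal (/ speed X rho) (Derive2 X rho).

Definition normal (X : R -> R * R) (rho : R) : R * R :=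
  opp (perp (tangent X rho)).

Definition diffquot (dt : R) (X Y : R -> R * R) (rho : R) : R * R :=
  scal (/ dt) (minus (Y rho) (X rho)).

Definition ip (u v : R -> R) : R := RInt (fun rho => u rho * v rho) 0 1.

Definition ip2 (u v : R -> R * R) : R :=
  RInt (fun rho => dot (u rho) (v rho)) 0 1.

Definition left_limit (w : R -> R) (x : R) : R := lim (filtermap w (at_left x)).

Definition right_limit (w : R -> R) (x : R) : R := lim (filtermap w (at_right x)).

Definition lumped (J : nat) (w : R -> R) : R :=
  mesh J / 2 *
  sum_n_m (fun j => left_limit w (node J j) + right_limit w (node J (j - 1))) 1 J.

Definition iph (J : nat) (u v : R -> R) : R :=
  lumped J (fun rho => u rho * v rho).

Definition iph2 (J : nat) (u v : R -> R * R) : R :=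
  lumped J (fun rho => dot (u rho) (v rho)).

(* (X, vk) are the curve and varkappa at time t_m; the unknowns V', vk', X', ka'
   are the velocity, varkappa, curve and kappa at time t_(m+1). *)
Record scheme_step (J : nat) (lambda dt : R)
  (X : R -> R * R) (vk : R -> R)
  (V' vk' : R -> R) (X' : R -> R * R) (ka' : R -> R) : Prop := {
  step_V : Vh J V';
  step_vk : Vh J vk';
  step_X : Vh2 J X';
  step_ka : Vh J ka';
  step_velocity : forall phi, Vh J phi ->
    ip V' (fun r => phi r * speed X r) =
    ip (Derive vk') (fun r => Derive phi r * / speed X r)
    - 1 / 2 * ip (fun r => vk r ^ 2 * vk' r) (fun r => phi r * speed X r)
    + lambda * ip ka' (fun r => phi r * speed X r);
  step_curvature : forall chi, Vh J chi ->
    ip (fun r => (vk' r - vk r) / dt) (fun r => chi r * speed X r)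
    + 1 / 2 *
      ip (fun r => dot (diffquot dt (Derive2 X) (Derive2 X') r) (Derive2 X' r)
                   * / speed X r)
         (fun r => vk' r * chi r) =
    - ip (Derive V') (fun r => Derive chi r * / speed X r)
    + 1 / 2 * ip (fun r => vk r ^ 2 * V' r) (fun r => chi r * speed X r)
    + 1 / 2 * ip (fun r => dot (tangent X r) (diffquot dt X X' r))
                 (fun r => Derive vk' r * chi r - vk' r * Derive chi r);
  step_normal_velocity : forall xi, Vh J xi ->
    iph J (fun r => dot (normal X r) (diffquot dt X X' r))
          (fun r => xi r * speed X r) =
    ip V' (fun r => xi r * speed X r);
  step_curvature_vector : forall eta, Vh2 J eta ->
    iph2 J (fun r => scal (ka' r) (normal X r))
           (fun r => scal (speed X r) (eta r)) =
    - ip2 (Derive2 X') (fun r => scal (/ speed X r) (Derive2 eta r))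
}.

Definition energy (lambda : R) (vk : R -> R) (X : R -> R * R) : R :=
  1 / 2 * ip (fun r => vk r ^ 2) (speed X) + lambda * ip (speed X) (fun _ => 1).

Definition time_step (T : R) (M : nat) : R := T / INR M.

(* Main.v *)
(** Testing the four equations with [V'], [vk'], [ka'] and the difference
    quotient of the curve makes the cross terms cancel; what remains of the
    energy balance is bounded below by the pointwise inequality
    [q . (q - p) / |p| >= |q| - |p|] for [p = X_rho], [q = X'_rho]. *)

Require Import Defs.
From Stdlib Require Import Reals Lra Lia FunctionalExtensionality.
From Coquelicot Require Import Coquelicot.
Open Scope R_scope.

(** * Functions that are regular on each open mesh element *)

(** Values at the nodes are left free, since [Derive] is meaningless at a kink. Asking [g] to be
    continuous on all of R encodes the existence of finite one-sided limits at the ends of the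
    element. *)
Definition piecewise_continuous (J : nat) (f : R -> R) : Prop :=
  forall j, (1 <= j <= J)%nat -> exists g : R -> R,
    (forall x, continuous g x) /\
    forall x, node J (j - 1) < x < node J j -> f x = g x.

Definition piecewise_constant (J : nat) (f : R -> R) : Prop :=
  forall j, (1 <= j <= J)%nat -> exists c : R,
    forall x, node J (j - 1) < x < node J j -> f x = c.

Lemma node_0 (J : nat) : node J 0 = 0.
Proof. unfold node; simpl; ring. Qed.

Lemma node_last (J : nat) (hJ : (1 <= J)%nat) : node J J = 1.
Proof.
  unfold node, mesh; apply Rinv_r, not_0_INR; lia.
Qed.

Lemma node_le (J j k : nat) (hJ : (1 <= J)%nat) (hjk : (j <= k)%nat) :
  node J j <= node J k.
Proof.
  unfold node, mesh; apply Rmult_le_compat_r.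
  - left; apply Rinv_0_lt_compat, lt_0_INR; lia.
  - now apply le_INR.
Qed.

Lemma piecewise_constant_continuous (J : nat) (f : R -> R) :
  piecewise_constant J f -> piecewise_continuous J f.
Proof.
  intros hf j hj; destruct (hf j hj) as [c hc].
  exists (fun _ => c); split; [intros x; apply continuous_const | exact hc].
Qed.

Lemma piecewise_continuous_const (J : nat) (c : R) :
  piecewise_continuous J (fun _ => c).
Proof. intros j hj; exists (fun _ => c); split; [intros x; apply continuous_const | easy]. Qed.

Lemma piecewise_continuous_plus (J : nat) (f g : R -> R) :
  piecewise_continuous J f -> piecewise_continuous J g ->
  piecewise_continuous J (fun x => f x + g x).
Proof.
  intros hf hg j hj.
  destruct (hf j hj) as [f0 [cf ef]]; destruct (hg j hj) as [g0 [cg eg]].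
  exists (fun x => f0 x + g0 x); split.
  - intros x; apply (continuous_plus f0 g0); auto.
  - intros x hx; now rewrite ef, eg.
Qed.

Lemma piecewise_continuous_mult (J : nat) (f g : R -> R) :
  piecewise_continuous J f -> piecewise_continuous J g ->
  piecewise_continuous J (fun x => f x * g x).
Proof.
  intros hf hg j hj.
  destruct (hf j hj) as [f0 [cf ef]]; destruct (hg j hj) as [g0 [cg eg]].
  exists (fun x => f0 x * g0 x); split.
  - intros x; apply (continuous_mult f0 g0); auto.
  - intros x hx; now rewrite ef, eg.
Qed.

Lemma piecewise_continuous_minus (J : nat) (f g : R -> R) :
  piecewise_continuous J f -> piecewise_continuous J g ->
  piecewise_continuous J (fun x => f x - g x).
Proof.
  intros hf hg j hj.
  destruct (hf j hj) as [f0 [cf ef]]; destruct (hg j hj) as [g0 [cg eg]].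
  exists (fun x => f0 x - g0 x); split.
  - intros x; apply (continuous_minus f0 g0); auto.
  - intros x hx; now rewrite ef, eg.
Qed.

(** * Integrability and monotonicity of the integral, element by element *)

Lemma piecewise_continuous_ex_RInt_node (J k : nat) (f : R -> R)
  (hJ : (1 <= J)%nat) (hf : piecewise_continuous J f) (hk : (S k <= J)%nat) :
  ex_RInt f (node J k) (node J (S k)).
Proof.
  destruct (hf (S k)) as [g [cg eg]]; [lia|].
  replace (S k - 1)%nat with k in eg by lia.
  apply ex_RInt_ext with g.
  - rewrite Rmin_left, Rmax_right by (apply node_le; lia).
    intros x hx; now rewrite eg.
  - apply (ex_RInt_continuous (V := R_CompleteNormedModule)); auto.
Qed.

Lemma piecewise_continuous_ex_RInt_0 (J k : nat) (f : R -> R)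
  (hJ : (1 <= J)%nat) (hf : piecewise_continuous J f) (hk : (k <= J)%nat) :
  ex_RInt f 0 (node J k).
Proof.
  induction k as [|k IH].
  - rewrite node_0; apply ex_RInt_point.
  - apply ex_RInt_Chasles with (node J k); [apply IH; lia|].
    now apply piecewise_continuous_ex_RInt_node.
Qed.

Lemma piecewise_continuous_ex_RInt (J : nat) (f : R -> R)
  (hJ : (1 <= J)%nat) (hf : piecewise_continuous J f) : ex_RInt f 0 1.
Proof.
  rewrite <- (node_last J hJ).
  now apply piecewise_continuous_ex_RInt_0.
Qed.

(** The pointwise bounds are available only off the nodes, so the integral is built up one element
    at a time: the upper limit is generalized from 1 to an arbitrary node, and the induction uses
    Chasles' relation. *)
Lemma RInt_le_piecewise (J : nat) (f g : R -> R) (hJ : (1 <= J)%nat)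
  (hf : piecewise_continuous J f) (hg : piecewise_continuous J g)
  (hfg : forall j x, (1 <= j <= J)%nat ->
     node J (j - 1) < x < node J j -> f x <= g x) :
  RInt f 0 1 <= RInt g 0 1.
Proof.
  enough (H : forall k, (k <= J)%nat ->
            RInt f 0 (node J k) <= RInt g 0 (node J k)).
  { rewrite <- (node_last J hJ); now apply H. }
  induction k as [|k IH]; intros hk.
  - rewrite node_0, !RInt_point; apply Rle_refl.
  - rewrite <- (RInt_Chasles f 0 (node J k)), <- (RInt_Chasles g 0 (node J k))
      by first [apply piecewise_continuous_ex_RInt_0; (easy || lia)
               |apply piecewise_continuous_ex_RInt_node; easy].
    apply Rplus_le_compat; [apply IH; lia|].
    apply RInt_le; try (apply piecewise_continuous_ex_RInt_node; easy).
    + apply node_le; lia.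
    + intros x hx; apply (hfg (S k)); [lia|].
      now replace (S k - 1)%nat with k by lia.
Qed.

(** This is the common shape of the two increment estimates: an energy difference on the left, at
    most two terms of the scheme on the right. It reduces each of them to a pointwise inequality
    inside an element. *)
Lemma RInt_lin_le (J : nat) (f g p q : R -> R) (a b c : R) (hJ : (1 <= J)%nat)
  (hf : piecewise_continuous J f) (hg : piecewise_continuous J g)
  (hp : piecewise_continuous J p) (hq : piecewise_continuous J q)
  (h : forall j x, (1 <= j <= J)%nat -> node J (j - 1) < x < node J j ->
     c * (f x - g x) <= a * p x + b * q x) :
  c * (RInt f 0 1 - RInt g 0 1) <= a * RInt p 0 1 + b * RInt q 0 1.
Proof.
  assert (If := piecewise_continuous_ex_RInt J f hJ hf).
  assert (Ig := piecewise_continuous_ex_RInt J g hJ hg).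
  assert (Ip := piecewise_continuous_ex_RInt J p hJ hp).
  assert (Iq := piecewise_continuous_ex_RInt J q hJ hq).
  assert (E1 : RInt (fun x => c * (f x - g x)) 0 1 = c * (RInt f 0 1 - RInt g 0 1)).
  { apply is_RInt_unique, (is_RInt_scal (fun x => f x - g x)).
    apply (is_RInt_minus f g); now apply (RInt_correct (V := R_CompleteNormedModule)). }
  assert (E2 : RInt (fun x => a * p x + b * q x) 0 1 = a * RInt p 0 1 + b * RInt q 0 1).
  { apply is_RInt_unique, (is_RInt_plus (fun x => a * p x) (fun x => b * q x)).
    - apply (is_RInt_scal p); now apply (RInt_correct (V := R_CompleteNormedModule)).
    - apply (is_RInt_scal q); now apply (RInt_correct (V := R_CompleteNormedModule)). }
  rewrite <- E1, <- E2; apply (RInt_le_piecewise J); trivial.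
  - apply piecewise_continuous_mult; [apply piecewise_continuous_const|].
    now apply piecewise_continuous_minus.
  - apply piecewise_continuous_plus; apply piecewise_continuous_mult;
      trivial; apply piecewise_continuous_const.
Qed.

(** * Finite element functions, their derivatives and difference quotients *)

Lemma Vh_piecewise_continuous (J : nat) (f : R -> R) :
  Vh J f -> piecewise_continuous J f.
Proof. intros hf j _; exists f; split; [apply hf | easy]. Qed.

Lemma affine_is_derive (f : R -> R) (a b u v x : R)
  (hf : forall r, u <= r <= v -> f r = a + b * r) (hx : u < x < v) :
  is_derive f x b.
Proof.
  apply is_derive_ext_loc with (fun r => a + b * r).
  - apply (locally_interval _ x u v); simpl; try tauto.
    intros y h1 h2; symmetry; apply hf; simpl in *; lra.
  - auto_derive; trivial; ring.
Qed.

Lemma Vh_ex_derive (J j : nat) (f : R -> R) (x : R) :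
  Vh J f -> (1 <= j <= J)%nat -> node J (j - 1) < x < node J j -> ex_derive f x.
Proof.
  intros [_ [_ hf]] hj hx; destruct (hf j hj) as [a [b hab]].
  exists b; now apply affine_is_derive with a (node J (j - 1)) (node J j).
Qed.

Lemma Vh_Derive_piecewise_constant (J : nat) (f : R -> R) :
  Vh J f -> piecewise_constant J (Derive f).
Proof.
  intros [_ [_ hf]] j hj; destruct (hf j hj) as [a [b hab]].
  exists b; intros x hx.
  now apply is_derive_unique, affine_is_derive with a (node J (j - 1)) (node J j).
Qed.

Lemma Vh_diffquot (J : nat) (dt : R) (f g : R -> R) :
  Vh J f -> Vh J g -> Vh J (fun r => / dt * (g r - f r)).
Proof.
  intros [pf [cf af]] [pg [cg ag]]; split; [|split].
  - intros r; now rewrite pf, pg.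
  - intros r; apply (continuous_scal_r (/ dt) (fun r => g r - f r)).
    apply (continuous_minus g f); auto.
  - intros j hj; destruct (af j hj) as [a [b hf]]; destruct (ag j hj) as [c [d hg]].
    exists (/ dt * (c - a)), (/ dt * (d - b)); intros r hr.
    rewrite hf, hg by easy; ring.
Qed.

(** Makes the discrete time derivative of the curve an admissible test function in the curvature
    vector equation. *)
Lemma Vh2_diffquot (J : nat) (dt : R) (X Y : R -> R * R) :
  Vh2 J X -> Vh2 J Y -> Vh2 J (diffquot dt X Y).
Proof.
  intros [hX1 hX2] [hY1 hY2]; split.
  - exact (Vh_diffquot J dt _ _ hX1 hY1).
  - exact (Vh_diffquot J dt _ _ hX2 hY2).
Qed.

Lemma Derive_diffquot (dt : R) (f g : R -> R) (x : R) :
  ex_derive f x -> ex_derive g x ->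
  Derive (fun r => / dt * (g r - f r)) x = / dt * (Derive g x - Derive f x).
Proof. intros hf hg; rewrite Derive_scal, Derive_minus; trivial. Qed.

Lemma Derive2_diffquot (J j : nat) (dt : R) (X Y : R -> R * R) (x : R) :
  Vh2 J X -> Vh2 J Y -> (1 <= j <= J)%nat -> node J (j - 1) < x < node J j ->
  Derive2 (diffquot dt X Y) x = diffquot dt (Derive2 X) (Derive2 Y) x.
Proof.
  intros [hX1 hX2] [hY1 hY2] hj hx.
  apply injective_projections.
  - apply (Derive_diffquot dt (fun r => fst (X r)) (fun r => fst (Y r)));
      now apply (Vh_ex_derive J j).
  - apply (Derive_diffquot dt (fun r => snd (X r)) (fun r => snd (Y r)));
      now apply (Vh_ex_derive J j).
Qed.

Lemma speed_piecewise_constant (J : nat) (X : R -> R * R) :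
  Vh2 J X -> piecewise_constant J (speed X).
Proof.
  intros [h1 h2] j hj.
  destruct (Vh_Derive_piecewise_constant J _ h1 j hj) as [a ha].
  destruct (Vh_Derive_piecewise_constant J _ h2 j hj) as [b hb].
  exists (enorm (a, b)); intros x hx.
  unfold speed, Derive2; now rewrite ha, hb.
Qed.

(** Constancy survives inversion even for the value 0, because [/] is total; continuity would
    require a nonvanishing extension. This is the reason for treating [speed] as piecewise constant
    first. *)
Lemma piecewise_constant_inv (J : nat) (f : R -> R) :
  piecewise_constant J f -> piecewise_constant J (fun x => / f x).
Proof.
  intros hf j hj; destruct (hf j hj) as [c hc].
  exists (/ c); intros x hx; now rewrite hc.
Qed.

Lemma dot_piecewise_continuous (J : nat) (F G : R -> R * R) :
  piecewise_continuous J (fun r => fst (F r)) ->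
  piecewise_continuous J (fun r => snd (F r)) ->
  piecewise_continuous J (fun r => fst (G r)) ->
  piecewise_continuous J (fun r => snd (G r)) ->
  piecewise_continuous J (fun r => dot (F r) (G r)).
Proof.
  intros; apply piecewise_continuous_plus; now apply piecewise_continuous_mult.
Qed.

(** * The Euclidean inequality behind the estimates *)

Lemma dot_nonneg (p : R * R) : 0 <= dot p p.
Proof. apply Rplus_le_le_0_compat; apply Rle_0_sqr. Qed.

Lemma enorm_sqr (p : R * R) : enorm p * enorm p = dot p p.
Proof. apply sqrt_sqrt, dot_nonneg. Qed.

Lemma dot_le_enorm (p q : R * R) : dot p q <= enorm p * enorm q.
Proof.
  unfold enorm; rewrite <- sqrt_mult by apply dot_nonneg.
  apply Rle_trans with (Rabs (dot p q)); [apply Rle_abs|].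
  rewrite <- sqrt_Rsqr_abs; apply sqrt_le_1_alt.
  unfold dot, Rsqr; destruct p as [a b], q as [c d]; simpl.
  (* Lagrange's identity: the square of [a * d - b * c] is exactly the Cauchy-Schwarz defect. *)
  assert (H := Rle_0_sqr (a * d - b * c)); unfold Rsqr in H; nra.
Qed.

(** After multiplication by |p|, Cauchy-Schwarz bounds the right side below by |q| (|q| - |p|),
    which exceeds |p| (|q| - |p|) by the square of |q| - |p|. *)
Lemma enorm_diff_le (p q : R * R) :
  0 < enorm p -> enorm q - enorm p <= dot (minus q p) q * / enorm p.
Proof.
  intros hp.
  apply Rmult_le_reg_r with (enorm p); [easy|].
  rewrite Rmult_assoc, Rinv_l, Rmult_1_r by lra.
  assert (E : dot (minus q p) q = enorm q * enorm q - dot p q).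
  { rewrite enorm_sqr; unfold dot; destruct p, q; simpl.
    unfold minus, plus, opp; simpl; unfold plus, opp; simpl; ring. }
  assert (H := dot_le_enorm p q).
  assert (H' := Rle_0_sqr (enorm q - enorm p)); unfold Rsqr in H'.
  rewrite E; nra.
Qed.

Lemma dot_diffquot (dt : R) (F G : R -> R * R) (q : R * R) (r : R) :
  dot (diffquot dt F G r) q = / dt * dot (minus (G r) (F r)) q.
Proof.
  unfold dot, diffquot; simpl; unfold scal; simpl; unfold mult; simpl; ring.
Qed.

Lemma dot_piecewise_continuous_Derive2 (J : nat) (dt : R) (X Y : R -> R * R) :
  Vh2 J X -> Vh2 J Y ->
  piecewise_continuous J
    (fun r => dot (diffquot dt (Derive2 X) (Derive2 Y) r) (Derive2 Y r)).
Proof.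
  intros [hX1 hX2] [hY1 hY2].
  assert (dX1 := piecewise_constant_continuous J _ (Vh_Derive_piecewise_constant J _ hX1)).
  assert (dX2 := piecewise_constant_continuous J _ (Vh_Derive_piecewise_constant J _ hX2)).
  assert (dY1 := piecewise_constant_continuous J _ (Vh_Derive_piecewise_constant J _ hY1)).
  assert (dY2 := piecewise_constant_continuous J _ (Vh_Derive_piecewise_constant J _ hY2)).
  apply dot_piecewise_continuous; trivial.
  - apply (piecewise_continuous_mult J (fun _ => / dt)); [apply piecewise_continuous_const|].
    now apply (piecewise_continuous_minus J (Derive (fun r => fst (Y r)))).
  - apply (piecewise_continuous_mult J (fun _ => / dt)); [apply piecewise_continuous_const|].
    now apply (piecewise_continuous_minus J (Derive (fun r => snd (Y r)))).
Qed.

(** * Growth of the two energy contributions over one time step *)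

(** Integrates [enorm_diff_le], with p and q the old and new derivatives; the right side is the
    stiffness term of the curvature vector equation tested with the difference quotient. *)
Lemma length_increment_le (J : nat) (dt : R) (X Y : R -> R * R)
  (hJ : (1 <= J)%nat) (hdt : 0 < dt) (hX : Vh2 J X) (hY : Vh2 J Y)
  (hreg : regular J X) :
  ip (speed Y) (fun _ => 1) - ip (speed X) (fun _ => 1)
  <= dt * ip2 (Derive2 Y)
            (fun r => scal (/ speed X r) (Derive2 (diffquot dt X Y) r)).
Proof.
  assert (sX := speed_piecewise_constant J X hX).
  assert (sY := piecewise_constant_continuous J _ (speed_piecewise_constant J Y hY)).
  assert (iX := piecewise_constant_continuous J _ (piecewise_constant_inv J _ sX)).
  apply piecewise_constant_continuous in sX.
  destruct (Vh2_diffquot J dt X Y hX hY) as [hD1 hD2].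
  pose proof hY as [hY1 hY2].
  (* Only one term is needed on the right, so the second is padded with the zero function and
     coefficient 0; the factors 1 match the unfolded [ip]. *)
  assert (H := RInt_lin_le J (fun r => speed Y r * 1) (fun r => speed X r * 1)
    (fun r => dot (Derive2 Y r) (scal (/ speed X r) (Derive2 (diffquot dt X Y) r)))
    (fun _ => 0) dt 0 1 hJ).
  rewrite Rmult_0_l, Rplus_0_r, Rmult_1_l in H; apply H; clear H.
  - now apply piecewise_continuous_mult, piecewise_continuous_const.
  - now apply piecewise_continuous_mult, piecewise_continuous_const.
  - apply dot_piecewise_continuous.
    + now apply piecewise_constant_continuous, Vh_Derive_piecewise_constant.
    + now apply piecewise_constant_continuous, Vh_Derive_piecewise_constant.
    + apply (piecewise_continuous_mult J (fun r => / speed X r)); [easy|].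
      now apply piecewise_constant_continuous, Vh_Derive_piecewise_constant.
    + apply (piecewise_continuous_mult J (fun r => / speed X r)); [easy|].
      now apply piecewise_constant_continuous, Vh_Derive_piecewise_constant.
  - apply piecewise_continuous_const.
  - intros j x hj hx.
    rewrite (Derive2_diffquot J j) by easy.
    assert (hs := hreg j x hj hx).
    assert (K := enorm_diff_le (Derive2 X x) (Derive2 Y x) hs).
    replace (dot (Derive2 Y x) _) with
      (/ speed X x * dot (diffquot dt (Derive2 X) (Derive2 Y) x) (Derive2 Y x))
      by (unfold dot; simpl; unfold scal; simpl; unfold mult; simpl; ring).
    rewrite dot_diffquot; fold (speed X x) in K; fold (speed Y x) in K.
    apply Rle_trans with (speed Y x - speed X x); [right; ring|].
    apply Rle_trans with (1 := K); right; field.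
    split; lra.
Qed.

(** With p and q the old and new derivatives, the integrand l^2 |q| - k^2 |p| splits into l^2 (|q| -
    |p|), controlled by [enorm_diff_le], and (l^2 - k^2) |p|, controlled by 2 l (l - k) = l^2 - k^2
    + (l - k)^2. *)
Lemma curvature_increment_le (J : nat) (dt : R) (X Y : R -> R * R) (k l : R -> R)
  (hJ : (1 <= J)%nat) (hdt : 0 < dt) (hX : Vh2 J X) (hY : Vh2 J Y)
  (hreg : regular J X) (hk : Vh J k) (hl : Vh J l) :
  1 / 2 * (ip (fun r => l r ^ 2) (speed Y) - ip (fun r => k r ^ 2) (speed X))
  <= dt * ip (fun r => (l r - k r) / dt) (fun r => l r * speed X r)
   + dt / 2 *
     ip (fun r => dot (diffquot dt (Derive2 X) (Derive2 Y) r) (Derive2 Y r)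
                  * / speed X r)
        (fun r => l r * l r).
Proof.
  assert (sX := speed_piecewise_constant J X hX).
  assert (sY := piecewise_constant_continuous J _ (speed_piecewise_constant J Y hY)).
  assert (iX := piecewise_constant_continuous J _ (piecewise_constant_inv J _ sX)).
  apply piecewise_constant_continuous in sX.
  assert (ck := Vh_piecewise_continuous J k hk).
  assert (cl := Vh_piecewise_continuous J l hl).
  apply (RInt_lin_le J); trivial.
  - apply piecewise_continuous_mult; [|easy].
    simpl; repeat apply piecewise_continuous_mult;
      trivial; apply piecewise_continuous_const.
  - apply piecewise_continuous_mult; [|easy].
    simpl; repeat apply piecewise_continuous_mult;
      trivial; apply piecewise_continuous_const.
  - apply piecewise_continuous_mult; [|now apply piecewise_continuous_mult].
    apply piecewise_continuous_mult; [now apply piecewise_continuous_minus|].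
    apply piecewise_continuous_const.
  - apply piecewise_continuous_mult; [|now apply piecewise_continuous_mult].
    apply piecewise_continuous_mult; [|easy].
    now apply dot_piecewise_continuous_Derive2.
  - intros j x hj hx.
    assert (hs := hreg j x hj hx).
    assert (K := enorm_diff_le (Derive2 X x) (Derive2 Y x) hs).
    rewrite dot_diffquot; fold (speed X x) in K; fold (speed Y x) in K.
    set (d := dot _ _) in *.
    replace (dt * _ + _) with
      ((l x - k x) * l x * speed X x + 1 / 2 * (d * / speed X x) * (l x * l x))
      by (field; lra).
    (* [H1] is the length inequality weighted by l^2; [H2] is the nonnegative remainder (l - k)^2
       |p| that the estimate discards. *)
    assert (H1 := Rmult_le_compat_r _ _ _ (Rle_0_sqr (l x)) K).
    assert (H2 := Rmult_le_pos _ _ (Rle_0_sqr (l x - k x)) (Rlt_le _ _ hs)).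
    unfold Rsqr in H1, H2; nra.
Qed.

Theorem theorem6 (J M : nat) (T lambda : R)
  (X : nat -> R -> R * R) (V varkappa kappa : nat -> R -> R) (m : nat)
  (hJ : (1 <= J)%nat)
  (hlambda : 0 <= lambda)
  (hdt : 0 < time_step T M)
  (hm : (m < M)%nat)
  (hX : forall k, (k <= M)%nat -> Vh2 J (X k) /\ regular J (X k))
  (hvarkappa : Vh J (varkappa m))
  (hsol : scheme_step J lambda (time_step T M) (X m) (varkappa m)
            (V (S m)) (varkappa (S m)) (X (S m)) (kappa (S m))) :
  energy lambda (varkappa (S m)) (X (S m))
  + time_step T M * ip (V (S m)) (fun r => V (S m) r * speed (X m) r)
  <= energy lambda (varkappa m) (X m).
Proof.
  destruct (hX m) as [hXm hreg]; [lia|].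
  destruct hsol as [hV hk hX' hka e1 e2 e3 e4].
  specialize (e1 _ hV); specialize (e2 _ hk); specialize (e3 _ hka).
  specialize (e4 _ (Vh2_diffquot J (time_step T M) _ _ hXm hX')).
  assert (L := length_increment_le J _ _ _ hJ hdt hXm hX' hreg).
  assert (K := curvature_increment_le J _ _ _ _ _ hJ hdt hXm hX' hreg hvarkappa hk).
  unfold energy.
  set (dt := time_step T M) in *.
  set (s := speed (X m)) in *.
  set (v := V (S m)) in *; set (w := varkappa (S m)) in *;
    set (w0 := varkappa m) in *; set (ka := kappa (S m)) in *.
  assert (B : ip (Derive v) (fun r => Derive w r * / s r)
            = ip (Derive w) (fun r => Derive v r * / s r)).
  { apply RInt_ext; intros; simpl; ring. }
  assert (C : ip (fun r => w0 r ^ 2 * v r) (fun r => w r * s r)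
            = ip (fun r => w0 r ^ 2 * w r) (fun r => v r * s r)).
  { apply RInt_ext; intros; simpl; ring. }
  assert (D : ip v (fun r => ka r * s r) = ip ka (fun r => v r * s r)).
  { apply RInt_ext; intros; simpl; ring. }
  (* The tangential term of the scheme is antisymmetric in [varkappa (S m)] and the test function,
     so it vanishes when the two coincide. *)
  assert (Z : ip (fun r => dot (tangent (X m) r) (diffquot dt (X m) (X (S m)) r))
                (fun r => Derive w r * w r - w r * Derive w r) = 0).
  { transitivity (RInt (fun _ => 0) 0 1).
    - apply RInt_ext; intros; simpl; ring.
    - rewrite RInt_const; unfold scal; simpl; unfold mult; simpl; ring. }
  assert (N : iph J (fun r => dot (normal (X m) r) (diffquot dt (X m) (X (S m)) r))
                (fun r => ka r * s r)
            = iph2 J (fun r => scal (ka r) (normal (X m) r))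
                (fun r => scal (s r) (diffquot dt (X m) (X (S m)) r))).
  (* [lumped] depends on one-sided limits, not on an integral, so the two arguments are identified
     as functions. The identity is bilinear algebra and holds at every point, nodes included. *)
  { unfold iph, iph2; f_equal; apply functional_extensionality; intros r.
    unfold dot; simpl; unfold scal; simpl; unfold mult; simpl; ring. }
  (* The lumped product links the last two equations: [e3] now expresses the [kappa] term of [e1] as
     minus the stiffness term of the curve. *)
  rewrite B, C, Z in e2; rewrite N, e4, D in e3; rewrite <- e3 in e1.
  set (P := ip (fun r => (w r - w0 r) / dt) _) in *.
  set (Q := ip _ (fun r => w r * w r)) in *.
  set (A := ip v (fun r => v r * s r)) in *.
  set (W := ip2 _ _) in *.
  (* Sum of [e1] and [e2]: the stiffness terms [B] and the cubic terms [C] enter with opposite signs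
     and cancel. *)
  assert (balance : A + P + 1 / 2 * Q + lambda * W = 0) by lra.
  apply (Rmult_eq_compat_l dt) in balance.
  (* The sign of [lambda] enters here, to weight the length estimate; adding [K] and substituting
     [dt] times the balance leaves [- dt * A] as the bound on the energy increment. *)
  apply (Rmult_le_compat_l lambda) in L; [|easy].
  nra.
Qed.
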